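(* Let $p(\cdot)\in\mathcal{P}_0$ with $p(\cdot)\in LH$, let $W\in\mathscr{A}_{p(\cdot),\infty}$, let $d_1\in[\![d^{\rm lower}_{p(\cdot),\infty}(W),\frac{n}{p_-})$ and $d_2\in[\![d^{\rm upper}_{p(\cdot),\infty}(W),\infty)$, and let $\{A_Q\}_Q$ be a family of reducing operators of order $p(\cdot)$ for $W$ (indexed by all cubes $Q$ in $\mathbb{R}^n$). Then there exists a positive constant $C$ such that, for any cubes $Q$ and $R$ in $\mathbb{R}^n$, $$\left\|A_QA_R^{-1}\right\|\le C\max\left\{\left[\frac{l(R)}{l(Q)}\right]^{d_1},\left[\frac{l(Q)}{l(R)}\right]^{d_2}\right\}\left[1+\frac{|c_Q-c_R|}{l(Q)\vee l(R)}\right]^{\Delta},$$ where $\Delta:=d_1+d_2$.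
   Context: $m,n\in\mathbb{N}$; $M_m$ is the set of $m\times m$ complex matrices, with operator norm $\|\cdot\|$. $\mathcal{P}_0$ is the set of measurable $p:\mathbb{R}^n\to(0,\infty]$ with $p_-:=\operatorname{ess\,inf}_{x\in\mathbb{R}^n}p(x)>0$. A measurable real-valued function $r$ on $\mathbb{R}^n$ belongs to $LH$ if there is $C_0>0$ with $|r(x)-r(y)|\le -\frac{C_0}{\log|x-y|}$ whenever $|x-y|<\frac12$, and there are positive constants $r_\infty,C_\infty$ with $|r(x)-r_\infty|\le\frac{C_\infty}{\log(e+|x|)}$ for all $x$. For a measurable function $f$, $\|f\|_{L^{p(\cdot)}}:=\inf\{\lambda>0:\int_{\mathbb{R}^n}|f(x)/\lambda|^{p(x)}\,dx\le1\}$ (with $\inf\emptyset=\infty$). Cubes have finite positive edge length and edges parallel to the axes (not necessarily open or closed); $l(Q)$ is the edge length and $c_Q$ the center of $Q$; $\lambda Q$ is the cube with center $c_Q$ and edge length $\lambda l(Q)$; $a\vee b:=\max\{a,b\}$; $\fint_Q$ denotes the average $\frac1{|Q|}\int_Q$. A matrix weight is a function $W:\mathbb{R}^n\to M_m$ such that $W(x)$ is nonnegative definite and invertible for almost every $x$ and all entries of $W$ are locally integrable. $\mathscr{A}_{p(\cdot),\infty}$ is the class of matrix weights $W$ with $$\sup_Q\exp\left(\fint_Q\log\left(\frac{1}{\|\mathbf{1}_Q\|_{L^{p(\cdot)}}}\left\|\,\|W(\cdot)W^{-1}(y)\|\,\mathbf{1}_Q(\cdot)\right\|_{L^{p(\cdot)}}\right)dy\right)<\infty,$$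 the supremum being over all cubes. $A_Q\in M_m$ is a reducing operator of order $p(\cdot)$ for $W$ on $Q$ if it is positive definite and self-adjoint and, for all $\vec z\in\mathbb{C}^m$, $|A_Q\vec z|\sim\frac{1}{\|\mathbf{1}_Q\|_{L^{p(\cdot)}}}\left\|\,|W(\cdot)\vec z|\,\mathbf{1}_Q\right\|_{L^{p(\cdot)}}$ (two-sided bound) with positive equivalence constants depending only on $m$ and $p(\cdot)$. $W$ has $\mathscr{A}_{p(\cdot),\infty}$-lower dimension $d\in\mathbb{R}$ if there is $C>0$ such that, for all $\lambda\in[1,\infty)$ and all cubes $Q$, $$\exp\left(\fint_{\lambda Q}\log\left(\frac{1}{\|\mathbf{1}_Q\|_{L^{p(\cdot)}}}\left\|\,\|W(\cdot)W^{-1}(y)\|\,\mathbf{1}_Q\right\|_{L^{p(\cdot)}}\right)dy\right)\le C\lambda^d;$$ it has $\mathscr{A}_{p(\cdot),\infty}$-upper dimension $d$ if there is $C>0$ such that, for all $\lambda\in[1,\infty)$ and all cubes $Q$, $$\exp\left(\fint_{Q}\log\left(\frac{1}{\|\mathbf{1}_{\lambda Q}\|_{L^{p(\cdot)}}}\left\|\,\|W(\cdot)W^{-1}(y)\|\,\mathbf{1}_{\lambda Q}\right\|_{L^{p(\cdot)}}\right)dy\right)\le C\lambda^d.$$ $d^{\rm lower}_{p(\cdot),\infty}(W)$ is the infimum of all $d\in(0,\frac{n}{p_-})$ such that $W$ has $\mathscr{A}_{p(\cdot),\infty}$-lower dimension $d$, and $d^{\rm upper}_{p(\cdot),\infty}(W)$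 is the infimum of all $d\in(0,\infty)$ such that $W$ has $\mathscr{A}_{p(\cdot),\infty}$-upper dimension $d$. The interval $[\![d^{\rm lower}_{p(\cdot),\infty}(W),\frac{n}{p_-})$ is $[d^{\rm lower}_{p(\cdot),\infty}(W),\frac{n}{p_-})$ if $d^{\rm lower}_{p(\cdot),\infty}(W)$ is itself an $\mathscr{A}_{p(\cdot),\infty}$-lower dimension of $W$, and $(d^{\rm lower}_{p(\cdot),\infty}(W),\frac{n}{p_-})$ otherwise. The interval $[\![d^{\rm upper}_{p(\cdot),\infty}(W),\infty)$ is $[d^{\rm upper}_{p(\cdot),\infty}(W),\infty)$ if $d^{\rm upper}_{p(\cdot),\infty}(W)$ is itself an $\mathscr{A}_{p(\cdot),\infty}$-upper dimension of $W$, and $(d^{\rm upper}_{p(\cdot),\infty}(W),\infty)$ otherwise. *)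

(* Defs.v *)
From HB Require Import structures.
From mathcomp Require Import all_boot all_order all_algebra.
From mathcomp Require Import all_classical all_reals all_analysis.
From mathcomp Require Import measurable_realfun ess_sup_inf complex.

Set Implicit Arguments.
Unset Strict Implicit.
Unset Printing Implicit Defensive.

Import Order.TTheory GRing.Theory Num.Theory.
Import numFieldNormedType.Exports.

Local Open Scope classical_set_scope.
Local Open Scope ring_scope.

(* Lebesgue measure on R^n: the iterated product of the one-dimensional
   Lebesgue measure on the Borel (product) sigma-algebra of n-tuples, completed
   by Caratheodory's theorem, so that the measurable subsets of [Rn R n] are
   exactly the Lebesgue measurable ones. *)
Section lebesgue_measure_Rn.
Context {R : realType}.

Definition cons_pair n (x : measurableTypeR R * n.-tuple (measurableTypeR R)) :
  n.+1.-tuple (measurableTypeR R) := [tuple of x.1 :: x.2].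

Lemma measurable_cons_pair n : measurable_fun [set: _] (@cons_pair n).
Proof. exact: measurable_cons measurable_fst measurable_snd. Qed.

Section step.
Context n (mu : {measure set (n.-tuple (measurableTypeR R)) -> \bar R}).

Definition borel_lebesgue_step :
    set (n.+1.-tuple (measurableTypeR R)) -> \bar R :=
  pushforward (lebesgue_measure \x^ mu)%E (@cons_pair n).

Let step0 : borel_lebesgue_step set0 = 0%E.
Proof. by rewrite /borel_lebesgue_step /pushforward preimage_set0 measure0. Qed.

Let step_ge0 A : (0 <= borel_lebesgue_step A)%E.
Proof.
apply: integral_ge0 => // y _; apply: measure_ge0.
Qed.

Let step_sigma_additive : semi_sigma_additive borel_lebesgue_step.
Proof.
move=> F mF tF mUF; rewrite /borel_lebesgue_step /pushforward preimage_bigcup.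
apply: measure_semi_sigma_additive.
- by move=> k; rewrite -[X in measurable X]setTI; exact: measurable_cons_pair.
- apply/trivIsetP => /= i j _ _ ij; rewrite -preimage_setI.
  by move/trivIsetP : tF => /(_ _ _ _ _ ij) ->//; rewrite preimage_set0.
- rewrite -preimage_bigcup -[X in measurable X]setTI.
  exact: measurable_cons_pair.
Qed.

HB.instance Definition _ := isMeasure.Build _ _ _ borel_lebesgue_step
  step0 step_ge0 step_sigma_additive.

End step.

Fixpoint borel_lebesgue n :
    {measure set (n.-tuple (measurableTypeR R)) -> \bar R} :=
  match n with
  | 0 => dirac [tuple]
  | k.+1 => borel_lebesgue_step (borel_lebesgue k)
  end.

End lebesgue_measure_Rn.

Definition Rn (R : realType) (n : nat) : Type := n.-tuple (measurableTypeR R).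

Definition Rn_display (R : realType) (n : nat) : measure_display :=
  caratheodory_display (mu_ext (@borel_lebesgue R n)).

HB.instance Definition _ (R : realType) (n : nat) := Pointed.on (Rn R n).

HB.instance Definition _ (R : realType) (n : nat) :=
  @isMeasurable.Build (Rn_display R n) (Rn R n)
    (mu_ext (@borel_lebesgue R n)).-caratheodory
    (caratheodory_measurable_set0 _)
    (@caratheodory_measurable_setC _ _ _)
    (@caratheodory_measurable_bigcup _ _ _).

Definition lebesgue_Rn (R : realType) (n : nat) : set (Rn R n) -> \bar R :=
  mu_ext (@borel_lebesgue R n).

Section lebesgue_Rn_measure.
Context (R : realType) (n : nat).

Let lebesgue_Rn0 : @lebesgue_Rn R n set0 = 0%E.
Proof. exact: mu_ext0. Qed.

Let lebesgue_Rn_ge0 (A : set (Rn R n)) : (0 <= lebesgue_Rn A)%E.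
Proof. exact: mu_ext_ge0. Qed.

Let lebesgue_Rn_sigma_additive : semi_sigma_additive (@lebesgue_Rn R n).
Proof.
move=> F mF tF mUF; rewrite /lebesgue_Rn.
exact: caratheodory_measure_sigma_additive.
Qed.

HB.instance Definition _ := isMeasure.Build _ _ _ (@lebesgue_Rn R n)
  lebesgue_Rn0 lebesgue_Rn_ge0 lebesgue_Rn_sigma_additive.

End lebesgue_Rn_measure.

Section euclidean.
Context {R : realType} {n : nat}.
Implicit Types x y : Rn R n.

Definition euclid_norm x : R := Num.sqrt (\sum_(i < n) (tnth x i) ^+ 2).

Definition euclid_dist x y : R := Num.sqrt (\sum_(i < n) (tnth x i - tnth y i) ^+ 2).

End euclidean.

(* A cube is a product of intervals of the same length [cube_edge]; the flags
   tell which faces belong to it: [BSide true] is closed on the left,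
   [BSide false] is closed on the right. For n > 0, distinct records denote
   distinct sets. *)
Record cube (R : realType) (n : nat) := Cube {
  cube_center : Rn R n;
  cube_edge : {posnum R};
  lface : 'I_n -> bool;
  rface : 'I_n -> bool }.

Section cubes.
Context {R : realType} {n : nat}.
Implicit Types Q : cube R n.

Definition cube_set Q : set (Rn R n) := [set x | forall i,
  tnth x i \in Interval
    (BSide (lface Q i) (tnth (cube_center Q) i - (cube_edge Q)%:num / 2))
    (BSide (rface Q i) (tnth (cube_center Q) i + (cube_edge Q)%:num / 2))].

Definition dilate (lam : {posnum R}) Q : cube R n :=
  Cube (cube_center Q) (lam%:num * (cube_edge Q)%:num)%:pos (lface Q) (rface Q).

Definition cube_avg Q (f : Rn R n -> \bar R) : \bar R :=
  ((@lebesgue_Rn R n (cube_set Q))^-1 *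
   \int[@lebesgue_Rn R n]_(x in cube_set Q) f x)%E.

End cubes.

Section variable_exponents.
Context {R : realType} {n : nat}.
Implicit Types p : Rn R n -> \bar R.

Definition p_minus p : \bar R := ess_inf (@lebesgue_Rn R n) p.

Definition P0 p : Prop :=
  [/\ measurable_fun [set: Rn R n] p,
      (forall x, (0 < p x)%E) &
      (0 < p_minus p)%E].

Definition log_holder (r : Rn R n -> R) : Prop :=
  [/\ measurable_fun [set: Rn R n] r,
      (exists2 C0 : R, 0 < C0 &
         forall x y, euclid_dist x y < 2^-1 ->
           (* for x = y both sides are 0, as ln 0 = 0 and 0^-1 = 0 in R *)
           `|r x - r y| <= - (C0 / ln (euclid_dist x y))) &
      (exists roo Coo : R, [/\ 0 < roo, 0 < Coo &
         forall x, `|r x - roo| <= Coo / ln (expR 1 + euclid_norm x)])].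

(* LH consists of real-valued functions, so membership forces p finite. *)
Definition LH p : Prop := exists2 r : Rn R n -> R, p = EFin \o r & log_holder r.

(* t ^ q for t >= 0 and q in (0, +oo], with t ^ +oo = 0 if t <= 1 and +oo
   otherwise; the value at q = -oo is irrelevant. *)
Definition varpow (t : R) (q : \bar R) : \bar R :=
  match q with
  | EFin s => (t `^ s)%:E
  | +oo%E => if t <= 1 then 0%E else +oo%E
  | -oo%E => 0%E
  end.

Definition Lpnorm p (f : Rn R n -> R) : \bar R :=
  ereal_inf [set lam%:E | lam in [set lam : R | 0 < lam /\
    (\int[@lebesgue_Rn R n]_x varpow `|f x / lam|%R (p x) <= 1)%E]].

(* ||1_Q||^-1 * ||f 1_Q||, the normalized norm of f on Q *)
Definition cube_norm p (Q : cube R n) (f : Rn R n -> R) : \bar R :=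
  ((Lpnorm p \1_(cube_set Q))^-1 *
   Lpnorm p (fun x => f x * \1_(cube_set Q) x)%R)%E.

End variable_exponents.

Section complex_matrices.
Context {R : realType} {m : nat}.

Definition cvnorm (z : 'cV[R[i]]_m) : R :=
  Num.sqrt (\sum_(i < m) (Normc.normc (z i 0)) ^+ 2).

Definition opnorm (A : 'M[R[i]]_m) : R :=
  sup [set cvnorm (A *m z) | z in [set z | cvnorm z <= 1]].

Definition adjmx k l (A : 'M[R[i]]_(k, l)) : 'M[R[i]]_(l, k) :=
  map_mx Num.conj A^T.

(* In the order of R[i], 0 <= w means that w is real and nonnegative. *)
Definition nonneg_definite (A : 'M[R[i]]_m) : Prop :=
  forall z : 'cV[R[i]]_m, 0 <= (adjmx z *m A *m z) 0 0.

Definition positive_definite (A : 'M[R[i]]_m) : Prop :=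
  forall z : 'cV[R[i]]_m, z != 0 -> 0 < (adjmx z *m A *m z) 0 0.

End complex_matrices.

Section matrix_weights.
Context {R : realType} {n m : nat}.
Implicit Types (p : Rn R n -> \bar R) (W : Rn R n -> 'M[R[i]]_m).

Definition locally_integrableC (f : Rn R n -> R[i]) : Prop :=
  forall Q : cube R n,
    (@lebesgue_Rn R n).-integrable (cube_set Q)
      (EFin \o (fun x => complex.Re (f x))) /\
    (@lebesgue_Rn R n).-integrable (cube_set Q)
      (EFin \o (fun x => complex.Im (f x))).

Definition matrix_weight W : Prop :=
  {ae @lebesgue_Rn R n, forall x, nonneg_definite (W x) /\ W x \in unitmx} /\
  (forall i j, locally_integrableC (fun x => W x i j)).

(* exp (avg_{y in P} log (||1_Q||^-1 || ||W(.) W^-1(y)|| 1_Q ||)), where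
   lne 0 = -oo and expeR -oo = 0. [invmx] is the inverse for almost every y.
   The integral is that of the positive part minus that of the negative part;
   the latter is finite for a matrix weight, since ||W|| is locally integrable
   and ||W(x) W^-1(y)|| >= ||W(x)|| / ||W(y)||. *)
Definition Ainf_quantity p W (P Q : cube R n) : \bar R :=
  expeR (cube_avg P (fun y =>
    lne (cube_norm p Q (fun x => opnorm (W x *m invmx (W y)))))).

Definition Ainf p W : Prop :=
  matrix_weight W /\
  (ereal_sup [set Ainf_quantity p W Q Q | Q in [set: cube R n]] < +oo)%E.

Definition has_lower_dim p W (d : R) : Prop :=
  exists2 C : R, 0 < C & forall (lam : {posnum R}) (Q : cube R n),
    1 <= lam%:num ->
    (Ainf_quantity p W (dilate lam Q) Q <= (C * lam%:num `^ d)%:E)%E.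

Definition has_upper_dim p W (d : R) : Prop :=
  exists2 C : R, 0 < C & forall (lam : {posnum R}) (Q : cube R n),
    1 <= lam%:num ->
    (Ainf_quantity p W Q (dilate lam Q) <= (C * lam%:num `^ d)%:E)%E.

Definition n_over_pminus p : \bar R := ((n%:R)%:E / p_minus p)%E.

Definition d_lower p W : \bar R :=
  ereal_inf [set d%:E | d in [set d : R |
    [/\ 0 < d, (d%:E < n_over_pminus p)%E & has_lower_dim p W d]]].

Definition d_upper p W : \bar R :=
  ereal_inf [set d%:E | d in [set d : R | 0 < d /\ has_upper_dim p W d]].

Definition lower_interval p W : set R :=
  if `[< exists2 d : R, d_lower p W = d%:E & has_lower_dim p W d >]
  then [set d | (d_lower p W <= d%:E < n_over_pminus p)%E]
  else [set d | (d_lower p W < d%:E < n_over_pminus p)%E].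

Definition upper_interval p W : set R :=
  if `[< exists2 d : R, d_upper p W = d%:E & has_upper_dim p W d >]
  then [set d | (d_upper p W <= d%:E)%E]
  else [set d | (d_upper p W < d%:E)%E].

Definition reducing_operator (c1 c2 : R) p W (Q : cube R n)
    (A : 'M[R[i]]_m) : Prop :=
  [/\ positive_definite A, adjmx A = A &
      forall z : 'cV[R[i]]_m,
        (c1%:E * cube_norm p Q (fun x => cvnorm (W x *m z))
           <= (cvnorm (A *m z))%:E)%E /\
        ((cvnorm (A *m z))%:E
           <= c2%:E * cube_norm p Q (fun x => cvnorm (W x *m z)))%E].

(* The equivalence constants may depend on m and p but not on the cube. *)
Definition reducing_family p W (A : cube R n -> 'M[R[i]]_m) : Prop :=
  exists c1 c2 : R, [/\ 0 < c1, 0 < c2 &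
    forall Q, reducing_operator c1 c2 p W Q (A Q)].

End matrix_weights.

(* Main.v *)
Require Import Defs.
From HB Require Import structures.
From mathcomp Require Import all_boot all_order all_algebra.
From mathcomp Require Import all_classical all_reals all_analysis.
From mathcomp Require Import measurable_realfun ess_sup_inf complex.
From mathcomp Require Import ring lra.

Set Implicit Arguments.
Unset Strict Implicit.
Unset Printing Implicit Defensive.

Import Order.TTheory GRing.Theory Num.Theory.
Import numFieldNormedType.Exports.

Local Open Scope classical_set_scope.
Local Open Scope ring_scope.

(** The proof compares reducing operators through the weight itself. For a cube
    [S] contained in [S'] with l(S') <= 3 l(S), an arbitrary cube [Q] and a
    vector [z], the identity A_Q z = A_Q W(y)^-1 W(y) z gives, for almost every
    [y], the bound |A_Q z| <= c N_Q(||W W(y)^-1||) |W(y) z|, where N_Q is the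
    normalized norm on [Q]. Taking logarithms and averaging over [S] turns the
    first factor into the quantity that the dimensions of [W] control. What
    remains is to bound the geometric mean of h = |W(.) z| over [S] by
    N_S'(h), which is comparable to |A_S' z| ([Ainf_quantity_transfer]).

    That geometric mean is a variable-exponent Jensen inequality
    ([log_average_bound]). It needs no concavity argument: if [h / t] has modular
    at most 1 on [S'], then u <= exp u, applied to
    u = r(y) ln (h(y) / t) + ln |S| and divided by r(y), bounds ln (h(y) / t)
    by - ln |S| / r(y) plus a function whose mean over [S] is at most
    1 / r_-. So the claim reduces to finding a single number tau which is, up to
    constants, at least the norm of the indicator of [S'] and at most
    |S| ^ (mean over S of 1 / r). This is the only place where the log-Hoelder
    condition enters ([log_holder_indicator_scale]): for small cubes the
    exponent is replaced by its value at a point of the cube, for large ones by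
    its limit at infinity, up to an exceptional set near the origin whose
    measure is a small power of |S|.

    The proposition follows by two transfers. Write [R] for the second of the
    two cubes to be compared. With L = max (l(Q), l(R)) + |c_Q - c_R|, let [P]
    be the cube of edge L centred at c_Q and [P'] the cube of edge 3L centred at
    c_R, so that [P'] contains [P]. The lower dimension compares A_Q to A_P' by
    averaging over [P], the upper dimension compares A_P' to A_R by averaging
    over [R], and the product (L / l(Q)) ^ d1 (3L / l(R)) ^ d2 of the two losses
    is at most 3 ^ d2 times the claimed bound. Since the transfer allows [P] to
    be strictly smaller than [P'], the distance between the centres costs
    nothing else.

    The logarithmic averages in the definition of the class are integrals of
    functions that are not known to be measurable, so they are only ever bounded
    below by integrals of measurable functions ([ae_le_integral_lower]). *)

(** * Integrals of arbitrary functions *)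

Section integral_without_measurability.
Context d (T : measurableType d) (R : realType).
Variable mu : {measure set T -> \bar R}.
Local Open Scope ereal_scope.

(** The integral is a difference of two suprema over simple functions, each
    of which is monotone in the integrand whether or not it is measurable. *)
Lemma le_integral_pointwise (D : set T) (f g : T -> \bar R) :
  (forall x, D x -> f x <= g x) ->
  \int[mu]_(x in D) f x <= \int[mu]_(x in D) g x.
Proof.
move=> fg.
have fgD x : (f \_ D) x <= (g \_ D) x.
  by rewrite !patchE; case: ifPn => // /set_mem /fg.
rewrite /integral; apply: leeB; apply: ereal_sup_le => _ [h /= hle <-].
- exists h => // x; apply: le_trans (hle x) _.
  by rewrite !funeposE ge_max le_max fgD/= le_max lexx orbT.
- exists h => // x; apply: le_trans (hle x) _.
  by rewrite !funenegE ge_max le_max leeN2 fgD/= le_max lexx orbT.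
Qed.

(** Only the smaller function needs to be measurable: it can be changed to
    -oo on the exceptional null set without changing its integral. *)
Lemma ae_le_integral_lower (D : set T) (f g : T -> \bar R) :
  measurable D -> measurable_fun D f ->
  {ae mu, forall x, D x -> f x <= g x} ->
  \int[mu]_(x in D) f x <= \int[mu]_(x in D) g x.
Proof.
move=> mD mf [N [mN N0 subN]].
pose f' := fun x => if x \in ~` N then f x else -oo.
have -> : \int[mu]_(x in D) f x = \int[mu]_(x in D) f' x.
  apply: ae_eq_integral => //.
    apply: measurable_fun_if => //.
    - apply: (measurable_fun_bool true) => /=.
      rewrite (_ : _ @^-1` _ = ~` N); last first.
        by apply/seteqP; split=> x /=; [move/set_mem|move=> ?; rewrite mem_set].
      by apply: measurableI => //; exact: measurableC.
    - by apply: measurable_funS mf => // x [].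
  exists N; split => // x /=; apply: contra_notP => xN.
  by move=> _; rewrite /f' mem_set.
apply: le_integral_pointwise => x Dx; rewrite /f'.
case: ifPn => [/set_mem /= xN|_]; last by rewrite leNye.
by apply: contrapT => /= H; apply: xN; apply: subN => /= /(_ Dx).
Qed.

End integral_without_measurability.

(** * Measure and geometry of cubes *)

Section lebesgue_measure_of_cubes.
Context {R : realType}.
Local Open Scope ereal_scope.

Definition box n (I : 'I_n -> interval R) : set (n.-tuple (measurableTypeR R)) :=
  [set x | forall i, tnth x i \in I i].

Lemma measurable_box n (I : 'I_n -> interval R) : measurable (box I).
Proof.
rewrite (_ : box I = \bigcap_(i in [set: 'I_n])
   ((fun x : n.-tuple (measurableTypeR R) => tnth x i) @^-1` [set` I i])).
  apply: fin_bigcap_measurable; first exact: finite_finset.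
  move=> i _.
  rewrite -[X in measurable X]setTI.
  have mtnth := @measurable_tnth _ (measurableTypeR R) n i.
  by apply: mtnth => //; exact: measurable_itv.
by apply/seteqP; split=> x /= h i; [move=> _|]; exact: h.
Qed.

Lemma borel_lebesgue_box n (I : 'I_n -> interval R) (l : R) :
  (forall i, lebesgue_measure [set` I i] = l%:E) ->
  borel_lebesgue n (box I) = (l ^+ n)%:E.
Proof.
elim: n I => [|n IH] I Il /=.
  by rewrite diracE mem_set// => -[].
rewrite /borel_lebesgue_step /pushforward.
rewrite (_ : _ @^-1` _ = [set` I ord0] `*` box (fun i => I (lift ord0 i))).
  rewrite product_measure2E; [|exact: measurable_itv|exact: measurable_box].
  by rewrite [X in X * _](Il ord0) IH// exprS.
apply/seteqP; split=> -[a t] /=; rewrite /cons_pair /box /=.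
  move=> h; split; first by have := h ord0; rewrite tnth0.
  by move=> i; have := h (lift ord0 i); rewrite tnthS.
move=> [h0 h] i; case: (unliftP ord0 i) => [j ->|->].
  by rewrite tnthS.
by rewrite tnth0.
Qed.

Context {n : nat}.
Implicit Types Q : cube R n.

Lemma measurable_cube_set Q : measurable (cube_set Q).
Proof.
have := @caratheodory_measurable_mu_ext _ _ _ (@borel_lebesgue R n) _
  (@measurable_box n (fun i => Interval
    (BSide (lface Q i) (tnth (cube_center Q) i - (cube_edge Q)%:num / 2)%R)
    (BSide (rface Q i) (tnth (cube_center Q) i + (cube_edge Q)%:num / 2)%R))).
exact.
Qed.

Lemma lebesgue_cube_set Q :
  @lebesgue_Rn R n (cube_set Q) = ((cube_edge Q)%:num ^+ n)%:E.
Proof.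
rewrite /lebesgue_Rn measurable_mu_extE; last exact: measurable_box.
apply: borel_lebesgue_box => i; rewrite lebesgue_measure_itv.
rewrite lte_fin ltrBlDr -addrA -splitr ltrDl gt0//.
by rewrite -EFinB; congr EFin; field.
Qed.

End lebesgue_measure_of_cubes.
Section euclidean_geometry_of_cubes.
Context {R : realType} {n : nat}.
Implicit Types (x y : Rn R n) (Q : cube R n).

Lemma normB_le_euclid_dist x y i : `|tnth x i - tnth y i| <= euclid_dist x y.
Proof.
rewrite -sqrtr_sqr ler_wsqrtr// (bigD1 i)//= lerDl.
by apply: sumr_ge0 => j _; exact: sqr_ge0.
Qed.

Lemma norm_le_euclid_norm x i : `|tnth x i| <= euclid_norm x.
Proof.
rewrite -sqrtr_sqr ler_wsqrtr// (bigD1 i)//= lerDl.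
by apply: sumr_ge0 => j _; exact: sqr_ge0.
Qed.

Lemma euclid_dist_le x y (D : R) : (0 < n)%N -> 0 <= D ->
  (forall i, `|tnth x i - tnth y i| <= D) -> euclid_dist x y <= n%:R * D.
Proof.
move=> n0 D0 xyD.
have n1 : 1 <= n%:R :> R by rewrite ler1n.
have nD0 : 0 <= n%:R * D by rewrite mulr_ge0// (le_trans _ n1).
rewrite -(ger0_norm nD0) -sqrtr_sqr ler_wsqrtr//.
apply: (@le_trans _ _ (\sum_(i < n) D ^+ 2)).
  by apply: ler_sum => i _; rewrite -real_normK ?num_real// lerXn2r ?nnegrE.
rewrite sumr_const card_ord -[leLHS]mulr_natl exprMn ler_wpM2r ?sqr_ge0//.
by rewrite expr2 ler_peMl// (le_trans _ n1).
Qed.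

Lemma cube_set_le Q x : cube_set Q x ->
  forall i, `|tnth x i - tnth (cube_center Q) i| <= (cube_edge Q)%:num / 2.
Proof.
move=> Qx i; have := Qx i; rewrite itv_boundlr => /andP[xl xr].
rewrite ler_distl; apply/andP; split.
  by move: xl; case: (lface Q i); rewrite bnd_simp => // /ltW.
by move: xr; case: (rface Q i); rewrite bnd_simp => // /ltW.
Qed.

Lemma cube_set_lt Q x :
  (forall i, `|tnth x i - tnth (cube_center Q) i| < (cube_edge Q)%:num / 2) ->
  cube_set Q x.
Proof.
move=> xQ i; have := xQ i; rewrite ltr_distl => /andP[xl xr].
rewrite itv_boundlr; apply/andP; split.
  by case: (lface Q i); rewrite bnd_simp// ltW.
by case: (rface Q i); rewrite bnd_simp// ltW.
Qed.

Lemma cube_set_euclid_dist Q x y : (0 < n)%N ->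
  cube_set Q x -> cube_set Q y ->
  euclid_dist x y <= n%:R * (cube_edge Q)%:num.
Proof.
move=> n0 /cube_set_le xQ /cube_set_le yQ; apply: euclid_dist_le => // i.
rewrite (_ : tnth x i - tnth y i = tnth x i - tnth (cube_center Q) i
   - (tnth y i - tnth (cube_center Q) i)); last by ring.
by rewrite (le_trans (ler_normB _ _))// [leRHS]splitr lerD.
Qed.

Lemma cube_set_ae_exists Q (P : Rn R n -> Prop) :
  {ae @lebesgue_Rn R n, forall x, P x} -> exists2 x, cube_set Q x & P x.
Proof.
move=> [N [mN N0 PN]]; apply: contrapT => nP.
have QN : cube_set Q `<=` N.
  by move=> x Qx; apply: PN => /= Px; apply: nP; exists x.
have : @lebesgue_Rn R n (cube_set Q) = 0%E.
  exact: subset_measure0 (measurable_cube_set Q) mN QN N0.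
by rewrite lebesgue_cube_set => -[] /eqP; rewrite gt_eqF.
Qed.

End euclidean_geometry_of_cubes.

(** * Size of the indicator of a cube under a log-Hoelder exponent *)

Section nearby_exponents.
Context {R : realType}.
Implicit Types V q x M pm : R.

(** Here exp V plays the role of |S|: with tau = |S| ^ (1 / q), replacing the
    exponent x by q costs a bounded factor as soon as |x - q| |ln |S|| is
    bounded. *)
Lemma powR_near_exponent_le V q x M : 0 < q -> `|x - q| * `|V| <= M ->
  expR (V / q) `^ (- x) <= expR (M / q) / expR V.
Proof.
move=> q0 H; rewrite /powR gt_eqF ?expR_gt0// expRK -expRN -expRD ler_expR.
have : (q - x) * V <= M.
  by rewrite (le_trans _ H)// distrC -normrM ler_norm.
rewrite -(ler_pM2r (x := q^-1)) ?invr_gt0// => H'.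
rewrite (_ : - x * (V / q) = (q - x) * V / q - V) ?lerD2r//.
by field; rewrite gt_eqF.
Qed.

Lemma div_near_exponent_ge V q x M pm : 0 < pm <= x -> 0 < q ->
  `|x - q| * `|V| <= M -> V / q - M / (pm * q) <= V / x.
Proof.
move=> /andP[pm0 pmx] q0 H.
have x0 : 0 < x by exact: lt_le_trans pmx.
have M0 : 0 <= M by rewrite (le_trans _ H)// mulr_ge0.
have : (x - q) * V / (x * q) <= M / (pm * q).
  apply: (@le_trans _ _ (M / (x * q))).
    by rewrite ler_pM2r ?invr_gt0 ?mulr_gt0// (le_trans _ H)// -normrM ler_norm.
  by rewrite ler_wpM2l// lef_pV2 ?posrE ?mulr_gt0// ler_pM2r.
rewrite lerBlDr -lerBlDl; apply: le_trans.
by rewrite le_eqVlt; apply/orP; left; apply/eqP; field; rewrite !gt_eqF.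
Qed.

Lemma div_ge_opp a M x pm : 0 < pm <= x -> 0 <= M -> - M <= a ->
  - (M / pm) <= a / x.
Proof.
move=> /andP[pm0 pmx] M0 Ma.
have x0 : 0 < x by exact: lt_le_trans pmx.
apply: (@le_trans _ _ (- M / x)); last by rewrite ler_pM2r ?invr_gt0.
by rewrite mulNr lerN2 ler_wpM2l// lef_pV2.
Qed.

End nearby_exponents.

Section exponent_on_cubes.
Context {R : realType} {n : nat}.
Implicit Types (S : cube R n) (r g : Rn R n -> R) (B D : set (Rn R n)).
Local Notation leb := (@lebesgue_Rn R n).

Lemma integral_cst_indic_le D B (c k : R) :
  measurable D -> measurable B -> 0 <= c -> 0 <= k ->
  (\int[leb]_(x in D) (c + k * \1_B x)%:E <= c%:E * leb D + k%:E * leb B)%E.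
Proof.
move=> mD mB c0 k0.
under eq_integral do rewrite EFinD EFinM.
rewrite ge0_integralD//=; last 2 first.
- by move=> x _; rewrite mule_ge0.
- apply: measurable_funeM; apply/measurable_EFinP.
  by apply: measurable_funTS; exact: measurable_indic.
rewrite integral_cst// leeD2l// ge0_integralZl//=; last first.
  apply/measurable_EFinP.
  by apply: measurable_funTS; exact: measurable_indic.
rewrite integral_indic// lee_wpmul2l//.
by apply: le_measure; rewrite ?inE//; exact: measurableI.
Qed.

(** The number [tau] is comparable to the norms of the indicators of [S] and of
    [S']: the modular of the indicator of [S'] divided by [tau] is bounded, and
    ln tau is at most (ln |S|) / r on [S] up to a constant and an error [g] of
    bounded mean. The error is a function rather than its mean so that
    it can be absorbed pointwise under a later integral. *)
Definition indicator_scale r (C : R) (S S' : cube R n) (tau : R) g :=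
  [/\ 0 < tau, measurable_fun [set: Rn R n] g, (forall y, 0 <= g y),
      (\int[leb]_(y in cube_set S) (g y)%:E <= (C * (cube_edge S)%:num ^+ n)%:E)%E &
      {ae leb, forall y, cube_set S y ->
         ln tau - C - g y <= ln ((cube_edge S)%:num ^+ n) / r y} /\
      (\int[leb]_(x in cube_set S') (tau `^ (- r x))%:E <= C%:E)%E].

Lemma indicator_scale_le r C C' S S' tau g : C <= C' ->
  indicator_scale r C S S' tau g -> indicator_scale r C' S S' tau g.
Proof.
move=> CC' [t0 mg g0 Ig [ae I]]; split => //.
  by rewrite (le_trans Ig)// lee_fin ler_wpM2r.
split; last by rewrite (le_trans I)// lee_fin.
by apply: filterS ae => y H /H; apply: le_trans; rewrite lerB// lerB.
Qed.

Context {r : Rn R n -> R} {pm : R}.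
Hypotheses (n0 : (0 < n)%N) (mr : measurable_fun [set: Rn R n] r)
  (pm0 : 0 < pm) (rpm : {ae leb, forall x, pm <= r x}).

Let measurable_powr (tau : R) D :
  measurable_fun D (fun x => (tau `^ (- r x))%:E).
Proof.
apply/measurable_EFinP; apply: measurable_funTS.
apply: (measurableT_comp (measurable_powRr tau)).
exact: measurableT_comp.
Qed.

(** Off the exceptional set [B] the integrand has the size of 1 / |S|, which is
    integrated over a cube [S'] of measure at most 3 ^ n |S|. *)
Lemma integral_powr_le S S' (tau c k : R) B :
  (cube_edge S')%:num <= 3 * (cube_edge S)%:num ->
  measurable B -> 0 <= c -> 0 <= k ->
  {ae leb, forall x, cube_set S' x -> tau `^ (- r x) <=
     c / (cube_edge S)%:num ^+ n + k * \1_B x} ->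
  (\int[leb]_(x in cube_set S') (tau `^ (- r x))%:E <=
     (3 ^+ n * c)%:E + k%:E * leb B)%E.
Proof.
move=> SS' mB c0 k0 H.
have mS' := measurable_cube_set S'.
pose u x := (c / (cube_edge S)%:num ^+ n + k * \1_B x)%:E.
apply: (@le_trans _ _ (\int[leb]_(x in cube_set S') u x)%E).
  exact: ae_le_integral_lower.
apply: (le_trans (integral_cst_indic_le mS' mB _ k0)).
  by rewrite divr_ge0.
rewrite leeD2r// lebesgue_cube_set -EFinM lee_fin.
rewrite mulrAC ler_pdivrMr ?exprn_gt0// [X in _ <= X * _]mulrC -mulrA.
by rewrite ler_wpM2l// -exprMn lerXn2r ?nnegrE.
Qed.


(** When |S| is bounded above and below, tau = 1 works. *)
Lemma indicator_scale_medium : exists2 C : R, 0 < C & forall S S',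
  (cube_edge S')%:num <= 3 * (cube_edge S)%:num ->
  (6 * n%:R)^-1 <= (cube_edge S)%:num -> (cube_edge S)%:num <= 1 ->
  exists tau g, indicator_scale r C S S' tau g.
Proof.
have n1 : 1 <= n%:R :> R by rewrite ler1n.
have n6 : 1 <= 6 * n%:R :> R by lra.
have M0 : 0 <= ln (6 * n%:R) *+ n :> R by rewrite mulrn_wge0// ln_ge0.
have p3n : 0 < 3 ^+ n :> R by rewrite exprn_gt0.
set M := ln _ *+ n in M0.
have Mpm : 0 <= M / pm by rewrite divr_ge0// ltW.
exists (3 ^+ n + M / pm); first by rewrite ltr_wpDr.
move=> S S' SS' Sl Su; exists 1, (cst 0); split => //.
  by rewrite integral0 lee_fin mulr_ge0// addr_ge0// ltW.
split.
  apply: filterS rpm => y ry _; rewrite ln1 sub0r subr0.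
  apply: (@le_trans _ _ (- (M / pm))); first by rewrite lerN2 lerDr ltW.
  apply: div_ge_opp; rewrite ?pm0// lnXn// -mulNrn lerMn2r; apply/orP; right.
  by rewrite -lnV ?posrE ?ler_ln ?posrE ?invr_gt0//; lra.
under eq_integral do rewrite powR1.
rewrite integral_cst; last exact: measurable_cube_set.
rewrite mul1e /= lebesgue_cube_set lee_fin ler_wpDr// lerXn2r ?nnegrE//.
by rewrite (le_trans SS')// ler_piMr.
Qed.

(** The oscillation of r on a cube of edge l is at most a constant over
    - ln (3 n l), which exactly balances |ln |S|| = - n ln l. So r may be
    replaced by its value q at a point of [S], with tau = |S| ^ (1 / q). *)
Lemma indicator_scale_small (C0 : R) : 0 < C0 ->
  (forall x y, euclid_dist x y < 2^-1 ->
    `|r x - r y| <= - (C0 / ln (euclid_dist x y))) ->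
  exists2 C : R, 0 < C & forall S S', cube_set S `<=` cube_set S' ->
  (cube_edge S')%:num <= 3 * (cube_edge S)%:num ->
  (cube_edge S)%:num < (6 * n%:R)^-1 ->
  exists tau g, indicator_scale r C S S' tau g.
Proof.
move=> C00 hC0.
have n1 : 1 <= n%:R :> R by rewrite ler1n.
have ln2_gt0 : 0 < ln 2 :> R by rewrite ln_gt0 ?ltr1n.
have ln3n : 0 <= ln (3 * n%:R) :> R by rewrite ln_ge0//; lra.
pose M : R := C0 * (n%:R * (1 + ln (3 * n%:R) / ln 2)).
have M0 : 0 <= M.
  apply: mulr_ge0; first exact: ltW.
  apply: mulr_ge0 => //; apply: addr_ge0 => //.
  by apply: divr_ge0 => //; exact: ltW.
have p3n : 0 < 3 ^+ n :> R by rewrite exprn_gt0.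
exists (3 ^+ n * expR (M / pm) + M / (pm * pm)).
  by rewrite ltr_wpDr ?mulr_gt0 ?expR_gt0// divr_ge0// mulr_ge0// ltW.
move=> S S' sub SS' Sl.
set l := (cube_edge S)%:num in SS' Sl *.
have l0 : 0 < l by rewrite /l.
(* The point is chosen where the lower bound on r holds, which gives a lower
   bound on q that does not depend on the cube. *)
have [x0 Sx0 pmx0] := cube_set_ae_exists S rpm.
pose q := r x0; pose V := ln (l ^+ n).
have q0 : 0 < q by exact: lt_le_trans pmx0.
have eV : expR V = l ^+ n by rewrite lnK// posrE exprn_gt0.
have nl_lt : 3 * n%:R * l < 2^-1.
  have n6 : 0 < 6 * n%:R :> R by lra.
  by move: Sl; rewrite -[_^-1]div1r ltr_pdivlMr//; lra.
pose L := - ln (3 * n%:R * l).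
have nl0 : 0 < 3 * n%:R * l by rewrite mulr_gt0//; lra.
have L2 : ln 2 < L by rewrite /L ltrNr -lnV ?posrE// ltr_ln ?posrE// invr_gt0.
have L0 : 0 < L by exact: lt_trans L2.
have VE : `|V| <= L * (n%:R * (1 + ln (3 * n%:R) / ln 2)).
  rewrite /V lnXn// -[X in `|X|]mulr_natl normrM normr_nat mulrCA.
  apply: ler_wpM2l => //.
  have -> : ln l = - L - ln (3 * n%:R).
    by rewrite /L opprK [ln (_ * l)]lnM ?posrE//; [rewrite addrC addKr|lra].
  rewrite -opprD normrN ger0_norm ?addr_ge0//; last exact: ltW.
  rewrite mulrDr mulr1 lerD2l mulrCA ler_peMr// ler_pdivlMr// mul1r.
  exact: ltW.
have main x : cube_set S' x -> `|r x - q| * `|V| <= M.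
  move=> S'x.
  have dx : euclid_dist x x0 <= 3 * n%:R * l.
    apply: le_trans (cube_set_euclid_dist n0 S'x (sub _ Sx0)) _.
    by rewrite [3 * _]mulrC -mulrA ler_wpM2l.
  apply: (@le_trans _ _ (C0 / L * `|V|)).
    apply: ler_wpM2r => //; apply: le_trans (hC0 _ _ (le_lt_trans dx nl_lt)) _.
    rewrite -mulrN; apply: ler_wpM2l; first exact: ltW.
    have [->|d0] := eqVneq (euclid_dist x x0) 0.
      by rewrite ln0// invr0 oppr0 invr_ge0 ltW.
    have dgt0 : 0 < euclid_dist x x0 by rewrite lt_def d0 sqrtr_ge0.
    have Ld : L <= - ln (euclid_dist x x0) by rewrite lerN2 ler_ln ?posrE.
    by rewrite -invrN lef_pV2 ?posrE// (lt_le_trans L0).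
  apply: (@le_trans _ _ (C0 / L * (L * (n%:R * (1 + ln (3 * n%:R) / ln 2))))).
    by apply: ler_wpM2l => //; rewrite divr_ge0// ltW.
  by rewrite mulrA mulfVK ?gt_eqF.
exists (expR (V / q)), (cst 0); split => //.
- by rewrite expR_gt0.
- rewrite integral0 lee_fin mulr_ge0//; apply: addr_ge0.
  - by rewrite mulr_ge0 ?expR_ge0.
  - by rewrite divr_ge0// mulr_ge0// ltW.
split.
  apply: filterS rpm => y ry Sy.
  rewrite expRK -/V subr0.
  have := @div_near_exponent_ge _ V q (r y) M pm.
  rewrite pm0 ry => /(_ isT q0 (main _ (sub _ Sy))); apply: le_trans.
  rewrite lerB// (@le_trans _ _ (M / (pm * pm)))//.
    by rewrite ler_wpM2l// lef_pV2 ?posrE ?mulr_gt0// ler_pM2l.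
  by rewrite lerDr mulr_ge0 ?expR_ge0// ltW.
have h : {ae leb, forall x, cube_set S' x -> expR (V / q) `^ (- r x) <=
     expR (M / pm) / (cube_edge S)%:num ^+ n + 0 * \1_set0 x}.
  apply: nearW => x S'x; rewrite mul0r addr0 -/l -eV.
  apply: le_trans (powR_near_exponent_le q0 (main _ S'x)) _.
  rewrite ler_pM2r ?invr_gt0 ?expR_gt0// ler_expR ler_wpM2l//.
  by rewrite lef_pV2 ?posrE.
apply: le_trans (integral_powr_le SS' _ _ _ h) _ => //.
by rewrite mul0e adde0 lee_fin lerDl divr_ge0// mulr_ge0// ltW.
Qed.

(** For |S| >= 1 the exponent is replaced by its limit at infinity, with
    tau = |S| ^ (1 / roo). This costs a bounded factor where
    ln (e + |x|) >= th ln |S|. The remaining points lie in a cube [B] of edge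
    2 |S| ^ th around the origin. There, trivial bounds suffice, because
    the measure of [B] is a small power of |S|. *)
Lemma indicator_scale_large (roo Coo : R) : 0 < roo -> 0 < Coo ->
  (forall x, `|r x - roo| <= Coo / ln (expR 1 + euclid_norm x)) ->
  exists2 C : R, 0 < C & forall S S',
  (cube_edge S')%:num <= 3 * (cube_edge S)%:num ->
  1 <= (cube_edge S)%:num ->
  exists tau g, indicator_scale r C S S' tau g.
Proof.
move=> roo0 Coo0 hoo.
have n1 : 1 <= n%:R :> R by rewrite ler1n.
(* n th <= 1 / 2 makes |B| ln |S| at most a multiple of |S|, and n th <= pm / roo
   makes |B| tau ^ (- pm) bounded. *)
have [th [th0 thn thp]] : exists th : R,
    [/\ 0 < th, n%:R * th <= 2^-1 & n%:R * th <= pm / roo].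
  exists (Num.min 2^-1 (pm / roo) / n%:R).
  have np : n%:R != 0 :> R by rewrite gt_eqF//; lra.
  split; first by rewrite divr_gt0 ?lt_min ?invr_gt0 ?divr_gt0//; lra.
    by rewrite mulrCA divff// mulr1 ge_min lexx.
  by rewrite mulrCA divff// mulr1 ge_min lexx orbT.
pose K := Coo / th.
have K0 : 0 <= K by rewrite divr_ge0// ltW.
pose a1 := 3 ^+ n * expR (K / roo); pose a2 : R := 2 ^+ n.
pose a3 := K / (pm * roo); pose a4 := 2 ^+ n * (2 / roo).
have a1_gt0 : 0 < a1 by rewrite mulr_gt0 ?exprn_gt0 ?expR_gt0.
have a2_ge0 : 0 <= a2 by rewrite exprn_ge0.
have a3_ge0 : 0 <= a3 by rewrite divr_ge0// mulr_ge0// ltW.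
have a4_ge0 : 0 <= a4 by rewrite mulr_ge0 ?exprn_ge0// divr_ge0// ltW.
exists (a1 + a2 + a3 + a4); first by lra.
move=> S S' SS' Sl.
pose V := ln ((cube_edge S)%:num ^+ n).
have V0 : 0 <= V by rewrite ln_ge0// exprn_ege1.
have eV : expR V = (cube_edge S)%:num ^+ n by rewrite lnK// posrE exprn_gt0.
pose rho := expR (th * V).
have rho0 : 0 < 2 * rho by rewrite mulr_gt0 ?expR_gt0.
pose QB : cube R n :=
  Cube [tuple 0 | _ < n] (PosNum rho0) (fun=> true) (fun=> true).
pose B := cube_set QB.
have mB : measurable B by exact: measurable_cube_set.
have lB : leb B = (2 ^+ n * expR (n%:R * th * V))%:E.
  by rewrite lebesgue_cube_set/= exprMn -expRM_natl mulrA.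
have far x : ~ B x -> `|r x - roo| * `|V| <= K.
  move=> nBx.
  have xr : rho <= euclid_norm x.
    rewrite leNgt; apply/negP => xr; apply: nBx; apply: cube_set_lt => i /=.
    rewrite tnth_mktuple subr0 (le_lt_trans (norm_le_euclid_norm x i))//.
    by rewrite mulrAC divff ?mul1r.
  have lnge : th * V <= ln (expR 1 + euclid_norm x).
    rewrite -[leLHS]expRK ler_ln ?posrE ?expR_gt0//.
      by rewrite (le_trans xr)// lerDr expR_ge0.
    by rewrite ltr_wpDr ?expR_gt0// sqrtr_ge0.
  have lngt0 : 0 < ln (expR 1 + euclid_norm x).
    apply: ln_gt0; rewrite ltr_wpDr ?sqrtr_ge0//.
    by rewrite -[ltLHS]expR0 ltr_expR.
  rewrite (ger0_norm V0).
  apply: (@le_trans _ _ (Coo / ln (expR 1 + euclid_norm x) * V)).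
    exact: ler_wpM2r.
  rewrite -mulrA ler_wpM2l ?(ltW Coo0)// mulrC ler_pdivrMr//.
  by rewrite mulrC -ler_pdivrMr ?invr_gt0// invrK mulrC.
exists (expR (V / roo)), (fun y => V / roo * \1_B y); split.
- exact: expR_gt0.
- by apply: measurable_funM => //; exact: measurable_indic.
- by move=> y; rewrite mulr_ge0// divr_ge0// ltW.
- rewrite (_ : (fun y => _) = (fun y => (0 + V / roo * \1_B y)%:E)); last first.
    by apply/funext => y; rewrite add0r.
  apply: le_trans (integral_cst_indic_le _ mB _ _) _ => //.
  + exact: measurable_cube_set.
  + by rewrite divr_ge0// ltW.
  rewrite mul0e add0e lB -EFinM lee_fin -eV.
  apply: (@le_trans _ _ (2 ^+ n * (2 / roo) * expR V)); last first.
    by rewrite ler_pM2r ?expR_gt0// -/a4; lra.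
  have V2 : V <= 2 * expR (V / 2).
    by rewrite -ler_pdivrMl// mulrC (le_trans _ (expR_ge1Dx _))// lerDr.
  have e2 : expR V = expR (V / 2) * expR (V / 2) by rewrite -expRD -splitr.
  have e3 : expR (n%:R * th * V) <= expR (V / 2).
    by rewrite ler_expR mulrC ler_wpM2l.
  have VE : V * expR (n%:R * th * V) <= 2 * expR (V / 2) * expR (V / 2).
    by rewrite ler_pM ?expR_ge0.
  rewrite e2; move: (expR (n%:R * th * V)) (expR (V / 2)) VE => E1 E2 VE.
  rewrite (_ : V / roo * _ = 2 ^+ n / roo * (V * E1)); last by ring.
  rewrite (_ : _ * (E2 * E2) = 2 ^+ n / roo * (2 * E2 * E2)); last by ring.
  by rewrite ler_wpM2l// divr_ge0 ?exprn_ge0// ltW.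
split.
  apply: filterS rpm => y ry _; rewrite expRK -/V.
  have [By|nBy] := pselect (B y).
    rewrite indicE mem_set// mulr1.
    rewrite addrAC subrr sub0r; apply: (@le_trans _ _ 0); first by lra.
    by rewrite divr_ge0// (le_trans _ ry)// ltW.
  rewrite indicE memNset// mulr0 subr0.
  have := @div_near_exponent_ge _ V roo (r y) K pm.
  rewrite pm0 ry => /(_ isT roo0 (far _ nBy)); apply: le_trans.
  by rewrite lerB// -/a3; lra.
have h : {ae leb, forall x, cube_set S' x -> expR (V / roo) `^ (- r x) <=
     expR (K / roo) / (cube_edge S)%:num ^+ n + expR (- (pm / roo * V)) * \1_B x}.
  apply: filterS rpm => x rx S'x; rewrite -eV.
  have [Bx|nBx] := pselect (B x).
    rewrite indicE mem_set// mulr1 ler_wpDl// ?divr_ge0 ?expR_ge0//.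
    rewrite /powR gt_eqF ?expR_gt0// expRK ler_expR mulNr lerN2.
    by rewrite mulrAC -mulrA ler_wpM2r// divr_ge0// ltW.
  rewrite indicE memNset// mulr0 addr0.
  exact: powR_near_exponent_le (far _ nBx).
apply: le_trans (integral_powr_le SS' mB _ _ h) _ => //.
rewrite lB -EFinM -EFinD lee_fin -/a1.
suff : expR (- (pm / roo * V)) * (2 ^+ n * expR (n%:R * th * V)) <= a2 by lra.
rewrite mulrCA -expRD ler_piMr// -[leRHS]expR0 ler_expR.
by rewrite addrC subr_le0 ler_wpM2r.
Qed.

Lemma log_holder_indicator_scale : log_holder r ->
  exists2 C : R, 0 < C & forall S S', cube_set S `<=` cube_set S' ->
  (cube_edge S')%:num <= 3 * (cube_edge S)%:num ->
  exists tau g, indicator_scale r C S S' tau g.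
Proof.
move=> [_ [C0 C00 hC0] [roo [Coo [roo0 Coo0 hoo]]]].
have [Cs Cs0 hs] := indicator_scale_small C00 hC0.
have [Cm Cm0 hm] := indicator_scale_medium.
have [Cl Cl0 hl] := indicator_scale_large roo0 Coo0 hoo.
exists (Cs + Cm + Cl) => [|S S' sub SS']; first by rewrite !addr_gt0.
have [small|] := ltP (cube_edge S)%:num ((6 * n%:R)^-1).
  have [tau [g tg]] := hs S S' sub SS' small.
  by exists tau, g; apply: indicator_scale_le tg; lra.
have [large _|/ltW le1 ge6] := leP 1 (cube_edge S)%:num.
  have [tau [g tg]] := hl S S' SS' large.
  by exists tau, g; apply: indicator_scale_le tg; lra.
have [tau [g tg]] := hm S S' SS' ge6 le1.
by exists tau, g; apply: indicator_scale_le tg; lra.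
Qed.

End exponent_on_cubes.

(** * Variable Lebesgue norms and averages of logarithms *)

Section variable_norm.
Context {R : realType} {n : nat}.
Implicit Types (p : Rn R n -> \bar R) (f h : Rn R n -> R) (Q : cube R n).
Local Notation leb := (@lebesgue_Rn R n).

Lemma varpow_ge0 (a : R) (q : \bar R) : 0 <= a -> (0 <= varpow a q)%E.
Proof.
move=> a0; case: q => [s| |] //=; first by rewrite lee_fin powR_ge0.
by case: ifP => // _; rewrite leey.
Qed.

Lemma le_varpow (a b : R) (q : \bar R) : (0 < q)%E -> 0 <= a <= b ->
  (varpow a q <= varpow b q)%E.
Proof.
move=> + /andP[a0 ab]; case: q => [s| |] //= s0.
  rewrite lee_fin; rewrite lte_fin in s0.
  by rewrite ge0_ler_powR// ?nnegrE// ?(ltW s0)// (le_trans a0).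
have [b1|b1] := leP b 1; first by rewrite (le_trans ab b1).
by case: ifP => // _; rewrite leey.
Qed.

Lemma Lpnorm_ge0 p f : (0 <= Lpnorm p f)%E.
Proof. by apply: le_ereal_inf_tmp => _ [l /= [l0 _] <-]; rewrite lee_fin ltW. Qed.

Lemma Lpnorm_lt_modular p f (t : R) : (forall x, (0 < p x)%E) ->
  (Lpnorm p f < t%:E)%E ->
  (\int[leb]_x varpow `|f x / t|%R (p x) <= 1)%E.
Proof.
move=> p0 /ereal_inf_lt[_ [l /= [l0 Il] <-]]; rewrite lte_fin => lt.
have t0 : 0 < t by exact: lt_trans lt.
apply: le_trans (le_integral_pointwise _ _) Il => x _.
apply: le_varpow => //; rewrite normr_ge0/= !normrM ler_wpM2l//.
by rewrite !normfV !gtr0_norm// lef_pV2 ?posrE// ltW.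
Qed.

Lemma Lpnorm_le_scale p f h (s : R) : (forall x, (0 < p x)%E) -> 0 < s ->
  (forall x, `|f x| <= s * `|h x|) -> (Lpnorm p f <= s%:E * Lpnorm p h)%E.
Proof.
move=> p0 s0 fh; rewrite -lee_pdivrMl//.
apply: le_ereal_inf_tmp => _ [l /= [l0 Il] <-].
rewrite lee_pdivrMl// -EFinM; apply: ereal_inf_lbound.
exists (s * l) => //=; split; first exact: mulr_gt0.
apply: le_trans (le_integral_pointwise _ _) Il => x _.
apply: le_varpow => //; rewrite normr_ge0/= !normrM !normfV normrM.
rewrite (gtr0_norm s0) (gtr0_norm l0) invfM mulrA ler_pM2r ?invr_gt0//.
by rewrite ler_pdivrMr// mulrC.
Qed.

Lemma cube_norm_le_scale p Q f h (s : R) : (forall x, (0 < p x)%E) -> 0 < s ->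
  (forall x, `|f x| <= s * `|h x|) ->
  (cube_norm p Q f <= s%:E * cube_norm p Q h)%E.
Proof.
move=> p0 s0 fh; rewrite /cube_norm muleCA lee_wpmul2l ?inve_ge0 ?Lpnorm_ge0//.
apply: Lpnorm_le_scale => // x.
by rewrite !normrM mulrA ler_wpM2r.
Qed.

Context {r : Rn R n -> R} {pm : R}.
Hypotheses (mr : measurable_fun [set: Rn R n] r) (r0 : forall x, 0 < r x)
  (pm0 : 0 < pm) (rpm : {ae leb, forall x, pm <= r x}).
Let p : Rn R n -> \bar R := EFin \o r.

(** The factor (1 + C) ^ (1 / pm) >= 1 in the norm divides the modular by at least
    1 + C, because every exponent is at least [pm]. *)
Lemma Lpnorm_indicator_le (C tau : R) Q : 0 < C -> 0 < tau ->
  (\int[leb]_(x in cube_set Q) (tau `^ (- r x))%:E <= C%:E)%E ->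
  (Lpnorm p \1_(cube_set Q) <= ((1 + C) `^ pm^-1 * tau)%:E)%E.
Proof.
move=> C0 tau0 IC; set K := _ `^ _.
have C1 : 1 <= 1 + C by rewrite lerDl ltW.
have K1 : 1 <= K.
  rewrite -[leLHS](powRr0 (1 + C)); apply: ler_powR => //.
  by rewrite invr_ge0 ltW.
have K0 : 0 < K by exact: lt_le_trans K1.
have Kt0 : 0 < K * tau by exact: mulr_gt0.
apply: ereal_inf_lbound; exists (K * tau) => //=; split => //.
rewrite (_ : (fun x => _) = (fun x => ((K * tau) `^ (- r x))%:E) \_ (cube_set Q)).
  rewrite -integral_mkcond.
  have mQ := measurable_cube_set Q.
  have mpow (a : R) : measurable_fun (cube_set Q) (fun x => a `^ (- r x)).
    apply: measurable_funTS; apply: (measurableT_comp (measurable_powRr a)).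
    exact: measurableT_comp.
  apply: (@le_trans _ _ (\int[leb]_(x in cube_set Q)
      ((1 + C)^-1%:E * (tau `^ (- r x))%:E))%E).
    apply: ae_le_integral_lower => //; first exact/measurable_EFinP.
    apply: filterS rpm => x rx _; rewrite -EFinM lee_fin.
    rewrite powRM ?(ltW K0) ?(ltW tau0)// ler_wpM2r ?powR_ge0// -powRrM mulrN powRN.
    rewrite lef_pV2 ?posrE ?powR_gt0 ?addr_gt0//.
    rewrite -[leLHS]powRr1 ?(le_trans _ C1)//; apply: ler_powR => //.
    by rewrite mulrC ler_pdivlMr// mul1r.
  rewrite ge0_integralZl//; last 3 first.
  - exact/measurable_EFinP.
  - by move=> x _; rewrite lee_fin powR_ge0.
  - by rewrite lee_fin invr_ge0 (le_trans _ C1).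
  rewrite lee_pdivrMl; last exact: lt_le_trans C1.
  by rewrite mule1 (le_trans IC)// lee_fin lerDr.
apply/funext => x; rewrite patchE indicE; case: ifPn => _ /=.
  by rewrite mul1r gtr0_norm ?invr_gt0// -powR_inv1 ?ltW// -powRrM mulN1r.
by rewrite mul0r normr0 powR0// gt_eqF.
Qed.

(** Jensen's inequality for a variable exponent, in the form in which it is used:
    if b <= N h on [S], the geometric mean of [N] over [S] is at most [B], and
    the norm of [h] on [S'] is less than [t], then b is at most a constant times
    B t / tau. Averaging a lower bound for ln N, instead of an upper bound
    for ln h, leaves [N] free to be non-measurable. *)
Lemma log_average_bound (C B b t tau : R) (S S' : cube R n) g h
    (N : Rn R n -> \bar R) :
  cube_set S `<=` cube_set S' -> indicator_scale r C S S' tau g ->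
  0 < B -> 0 < b -> 0 < t -> measurable_fun (cube_set S) h ->
  (Lpnorm p (fun x => h x * \1_(cube_set S') x)%R < t%:E)%E ->
  {ae leb, forall y, cube_set S y -> 0 < h y /\ (b%:E <= N y * (h y)%:E)%E} ->
  (expeR (cube_avg S (fun y => lne (N y))) <= B%:E)%E ->
  b <= expR (2 * C + pm^-1) * B * (t / tau).
Proof.
move=> sub [tau0 mg g0 Ig [aeV _]] B0 b0 t0 mh /Lpnorm_lt_modular It aeN.
have mS := measurable_cube_set S.
set l := (cube_edge S)%:num in Ig aeV.
pose V := ln (l ^+ n).
have l0 : 0 < l ^+ n by rewrite exprn_gt0// /l.
have eV : expR V = l ^+ n by rewrite lnK.
(* This is (h / t) ^ r where h > 0, written so that it is visibly measurable. *)
pose f y := expR (r y * ln (h y / t)).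
have mf : measurable_fun (cube_set S) f.
  apply: measurableT_comp => //; apply: measurable_funM.
    exact: measurable_funTS.
  apply: (measurableT_comp (@measurable_ln R)).
  exact: measurable_funM.
have If : (\int[leb]_(y in cube_set S) (f y)%:E <= 1)%E.
  apply: le_trans (It _); last by move=> x; rewrite lte_fin.
  pose F x := varpow `|h x * \1_(cube_set S') x / t| (p x).
  apply: (@le_trans _ _ (\int[leb]_(y in cube_set S) F y)%E).
    apply: ae_le_integral_lower => //; first exact/measurable_EFinP.
    apply: filterS aeN => y H Sy; have [hy0 _] := H Sy.
    rewrite /F indicE mem_set ?mulr1; last exact: sub.
    rewrite gtr0_norm ?divr_gt0//= /f lee_fin /powR gt_eqF//.
    exact: divr_gt0.
  rewrite integral_mkcond; apply: le_integral_pointwise => x _.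
  by rewrite patchE; case: ifP => // _; exact: varpow_ge0.
pose k := ln (b / t) + ln tau - C.
pose G y := g y + l ^+ n / pm * f y.
have lpm0 : 0 <= l ^+ n / pm by rewrite divr_ge0// ltW.
have G0 y : 0 <= G y by rewrite addr_ge0// mulr_ge0// expR_ge0.
have mgS : measurable_fun (cube_set S) g by exact: measurable_funTS.
have mG : measurable_fun (cube_set S) G.
  by apply: measurable_funD => //; exact: measurable_funM.
have IG : (\int[leb]_(y in cube_set S) (G y)%:E <= ((C + pm^-1) * l ^+ n)%:E)%E.
  rewrite /G; under eq_integral do rewrite EFinD EFinM.
  rewrite ge0_integralD//; last 4 first.
  - by move=> y _; rewrite lee_fin.
  - exact/measurable_EFinP.
  - by move=> y _; rewrite -EFinM lee_fin mulr_ge0// expR_ge0.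
  - by apply: measurable_funeM; exact/measurable_EFinP.
  rewrite ge0_integralZl//; last 2 first.
  - exact/measurable_EFinP.
  - by move=> y _; rewrite lee_fin expR_ge0.
  rewrite mulrDl EFinD leeD//.
  by rewrite -[leRHS]mule1 [pm^-1 * _]mulrC lee_wpmul2l.
have iG : leb.-integrable (cube_set S) (EFin \o G).
  apply/integrableP; split; first exact/measurable_EFinP.
  apply: le_lt_trans (ltry ((C + pm^-1) * l ^+ n)); apply: le_trans IG.
  by apply: le_integral_pointwise => y _; rewrite /= ger0_norm.
have ik : leb.-integrable (cube_set S) (EFin \o cst k).
  apply/integrableP; split; first exact/measurable_EFinP/measurable_cst.
  rewrite (eq_integral (cst `|k|%:E))// integral_cst//=.
  by rewrite lebesgue_cube_set -EFinM ltry.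
have low : (\int[leb]_(y in cube_set S) (k - G y)%:E <=
            \int[leb]_(y in cube_set S) lne (N y))%E.
  apply: ae_le_integral_lower => //.
    by apply/measurable_EFinP; exact: measurable_funB.
  move: aeV aeN rpm; apply: filterS3 => y HV HN ry Sy.
  have [hy0 bN] := HN Sy.
  have ry0 := r0 y.
  have bhN : ((b / h y)%:E <= N y)%E.
    by rewrite EFinM muleC lee_pdivrMl// muleC.
  have bh0 : 0 < b / h y by rewrite divr_gt0.
  apply: (@le_trans _ _ (lne (b / h y)%:E)); last first.
    rewrite lee_lne// in_itv/= leey andbT.
      by rewrite lee_fin ltW.
    by rewrite (le_trans _ bhN)// lee_fin ltW.
  rewrite lne_EFin// lee_fin /G -eV.
  have := HV Sy; rewrite -/V => {}HV.
  (* u <= exp u for u = r(y) ln (h(y) / t) + ln |S|, divided by r(y) *)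
  have key : ln (h y / t) + V / r y <= expR V / pm * f y.
    apply: (@le_trans _ _ (expR V / r y * f y)).
      rewrite /f mulrAC -expRD ler_pdivlMr// mulrDl divfK ?gt_eqF//.
      rewrite [leLHS](_ : _ = V + r y * ln (h y / t)); last by ring.
      by rewrite (le_trans _ (expR_ge1Dx _))// lerDr.
    rewrite ler_wpM2r ?expR_ge0// ler_wpM2l ?expR_ge0//.
    by rewrite lef_pV2 ?posrE.
  move: key; rewrite /k !ln_div ?posrE// => key.
  lra.
have Ik : (\int[leb]_(y in cube_set S) (k - G y)%:E)%E =
    ((k * l ^+ n)%:E - \int[leb]_(y in cube_set S) (G y)%:E)%E.
  under eq_integral do rewrite EFinB.
  by rewrite integralB//= integral_cst//= lebesgue_cube_set -EFinM.
have -> : B%:E = expeR (ln B)%:E by rewrite /= lnK.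
rewrite lee_expeR.
rewrite /cube_avg lebesgue_cube_set inver gt_eqF// lee_pdivrMl// => avg.
have : ((k * l ^+ n)%:E <= (l ^+ n * ln B)%:E + ((C + pm^-1) * l ^+ n)%:E)%E.
  rewrite -leeBlDr//; apply: le_trans avg; apply: le_trans low.
  by rewrite Ik leeB.
rewrite -EFinD lee_fin [l ^+ n * _]mulrC -mulrDl ler_pM2r// /k => H.
have tt0 : 0 < t / tau by rewrite divr_gt0.
have rhs0 : 0 < expR (2 * C + pm^-1) * B * (t / tau).
  by rewrite !mulr_gt0 ?expR_gt0 ?invr_gt0.
have lnE : ln (expR (2 * C + pm^-1) * B * (t / tau)) =
    2 * C + pm^-1 + ln B + (ln t - ln tau).
  by rewrite !lnM ?posrE ?mulr_gt0 ?expR_gt0 ?invr_gt0// lnV// expRK.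
rewrite -ler_ln// lnE.
move: H; rewrite !ln_div ?posrE//; lra.
Qed.

End variable_norm.

(** * Complex vectors and matrices *)

Section complex_vectors.
Context {R : realType}.
Implicit Types m : nat.

Lemma cvnorm_ge0 m (z : 'cV[R[i]]_m) : 0 <= cvnorm z.
Proof. exact: sqrtr_ge0. Qed.

Lemma normc_le_cvnorm m (z : 'cV[R[i]]_m) i : Normc.normc (z i 0) <= cvnorm z.
Proof.
have nz : 0 <= Normc.normc (z i 0) by case: (z i 0) => a b; exact: sqrtr_ge0.
rewrite -(ger0_norm nz) -sqrtr_sqr ler_wsqrtr// (bigD1 i)//= lerDl.
by apply: sumr_ge0 => j _; exact: sqr_ge0.
Qed.

Lemma cvnorm0 m : cvnorm (0 : 'cV[R[i]]_m) = 0.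
Proof.
rewrite /cvnorm big1 ?sqrtr0// => i _.
by rewrite mxE (_ : Normc.normc 0 = 0) ?expr0n//; exact: Normc.normc0.
Qed.

Lemma cvnorm_gt0 m (z : 'cV[R[i]]_m) : z != 0 -> 0 < cvnorm z.
Proof.
move=> z0; rewrite lt_def cvnorm_ge0 andbT; apply: contra z0 => /eqP z0.
apply/eqP/colP => i; rewrite mxE; apply: Normc.eq0_normc; apply/eqP.
rewrite eq_le -{1}z0 normc_le_cvnorm/=.
by case: (z i 0) => a b; exact: sqrtr_ge0.
Qed.

Lemma cvnormZ m (c : R[i]) (z : 'cV[R[i]]_m) :
  cvnorm (c *: z) = Normc.normc c * cvnorm z.
Proof.
have c0 : 0 <= Normc.normc c by case: c => a b; exact: sqrtr_ge0.
rewrite /cvnorm -[in RHS](ger0_norm c0) -sqrtr_sqr -sqrtrM ?sqr_ge0//.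
rewrite mulr_sumr; congr Num.sqrt; apply: eq_bigr => i _.
by rewrite mxE Normc.normcM exprMn.
Qed.

(** Boundedness is what makes the supremum defining [opnorm] meaningful: the
    supremum of an unbounded set of reals is 0 by convention. *)
Lemma cvnorm_mulmx_bounded m (A : 'M[R[i]]_m) : exists M : R,
  forall z : 'cV_m, cvnorm z <= 1 -> cvnorm (A *m z) <= M.
Proof.
exists (Num.sqrt (\sum_i (\sum_j Normc.normc (A i j)) ^+ 2)) => z z1.
have nc0 (c : R[i]) : 0 <= Normc.normc c by case: c => a b; exact: sqrtr_ge0.
apply: ler_wsqrtr; apply: ler_sum => i _.
rewrite lerXn2r ?nnegrE ?sumr_ge0// mxE.
apply: (@le_trans _ _ (\sum_j Normc.normc (A i j * z j 0))).
  elim/big_ind2: _ => [|x1 x2 y1 y2 h1 h2|//].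
    by rewrite Normc.normc0.
  by rewrite (le_trans (le_normcD _ _))// lerD.
apply: ler_sum => j _; rewrite Normc.normcM ler_piMr//.
exact: le_trans (normc_le_cvnorm _ _) z1.
Qed.

Lemma cvnorm_mulmx_le m (A : 'M[R[i]]_m) (z : 'cV_m) :
  cvnorm (A *m z) <= opnorm A * cvnorm z.
Proof.
have [->|z0] := eqVneq z 0; first by rewrite mulmx0 cvnorm0 mulr0.
have nz := cvnorm_gt0 z0.
pose c : R[i] := ((cvnorm z)^-1)%:C%C.
have nc : Normc.normc c = (cvnorm z)^-1.
  rewrite /c /= expr0n/= addr0 sqrtr_sqr ger0_norm//.
  by rewrite invr_ge0 ltW.
have [M hM] := cvnorm_mulmx_bounded A.
have : cvnorm (A *m (c *: z)) <= opnorm A.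
  apply: ub_le_sup; first by exists M => _ [v /= v1 <-]; exact: hM.
  by exists (c *: z) => //=; rewrite cvnormZ nc mulVf// gt_eqF.
by rewrite -scalemxAr cvnormZ nc ler_pdivrMl// mulrC.
Qed.

Lemma opnorm_le m (A : 'M[R[i]]_m) (M : R) :
  (forall z, cvnorm z <= 1 -> cvnorm (A *m z) <= M) -> opnorm A <= M.
Proof.
move=> AM; apply: ge_sup; first by exists (cvnorm (A *m 0)), 0; rewrite //= cvnorm0.
by move=> _ [z /= z1 <-]; exact: AM.
Qed.

Lemma positive_definite_unitmx m (A : 'M[R[i]]_m) :
  positive_definite A -> A \in unitmx.
Proof.
move=> pdA; rewrite -unitmx_tr unitmxE unitfE; apply/negP => /det0P[v v0 vA].
have /pdA : v^T != 0.
  by apply: contra v0 => /eqP/(congr1 trmx); rewrite trmxK trmx0 => ->.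
rewrite -mulmxA (_ : A *m v^T = 0) ?mulmx0 ?mxE ?ltxx//.
by apply: trmx_inj; rewrite trmx_mul trmxK vA trmx0.
Qed.

Lemma unitmx_mulmx_neq0 m (A : 'M[R[i]]_m) (z : 'cV_m) :
  A \in unitmx -> z != 0 -> A *m z != 0.
Proof.
by move=> uA; apply: contra => /eqP Az; rewrite -(mulKmx uA z) Az mulmx0.
Qed.

Context {n m : nat}.
Implicit Types (S : cube R n) (W : Rn R n -> 'M[R[i]]_m).

Lemma measurable_cvnorm_mulmx W S (z : 'cV_m) :
  (forall i j, locally_integrableC (fun x => W x i j)) ->
  measurable_fun (cube_set S) (fun y => cvnorm (W y *m z)).
Proof.
move=> lW.
have mRe i j : measurable_fun (cube_set S) (fun y => complex.Re (W y i j)).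
  by have [/measurable_int/measurable_EFinP] := lW i j S.
have mIm i j : measurable_fun (cube_set S) (fun y => complex.Im (W y i j)).
  by have [_ /measurable_int/measurable_EFinP] := lW i j S.
apply: (measurableT_comp (continuous_measurable_fun (@sqrt_continuous R))).
apply: measurable_sum => i; apply: measurable_funX.
rewrite (_ : (fun y => _) = (fun y => Num.sqrt (
   (\sum_j (complex.Re (W y i j) * complex.Re (z j 0) -
            complex.Im (W y i j) * complex.Im (z j 0))) ^+ 2 +
   (\sum_j (complex.Re (W y i j) * complex.Im (z j 0) +
            complex.Im (W y i j) * complex.Re (z j 0))) ^+ 2))); last first.
  apply/funext => y; rewrite mxE.
  set s := \sum_(_ < _) _.
  have -> : Normc.normc s = Num.sqrt (complex.Re s ^+ 2 + complex.Im s ^+ 2).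
    by case: s.
  have ReD : {morph @complex.Re R : a b / a + b >-> a + b} by case=> ? ? [].
  have ImD : {morph @complex.Im R : a b / a + b >-> a + b} by case=> ? ? [].
  rewrite (big_morph _ ReD (erefl _)) (big_morph _ ImD (erefl _)).
  by congr (Num.sqrt (_ ^+ 2 + _ ^+ 2)); apply: eq_bigr => j _;
    case: (W y i j) (z j 0) => [a b] [c d].
apply: (measurableT_comp (continuous_measurable_fun (@sqrt_continuous R))).
apply: measurable_funD; apply: measurable_funX; apply: measurable_sum => j.
  by apply: measurable_funB; apply: measurable_funM => //; exact: measurable_cst.
by apply: measurable_funD; apply: measurable_funM => //; exact: measurable_cst.
Qed.

End complex_vectors.

(** * Comparison of reducing operators *)

Section reducing_operators.
Context {R : realType} {n m : nat}.
Implicit Types (Q S : cube R n) (W : Rn R n -> 'M[R[i]]_m).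
Local Notation leb := (@lebesgue_Rn R n).

Lemma Lpnorm_le_of_cube_norm (p : Rn R n -> \bar R) (h : Rn R n -> R) Q
    (u v : R) : 0 < u ->
  (Lpnorm p \1_(cube_set Q) <= u%:E)%E -> (cube_norm p Q h <= v%:E)%E ->
  (Lpnorm p (fun x => h x * \1_(cube_set Q) x)%R <= (u * v)%:E)%E.
Proof.
move=> u0 Lu hv; rewrite EFinM -lee_pdivrMl//; apply: le_trans hv.
apply: lee_wpmul2r; first exact: Lpnorm_ge0.
rewrite (_ : u^-1%:E = (u%:E)^-1%E); last by rewrite inver gt_eqF.
by rewrite lee_pV2// inE ?Lpnorm_ge0// lee_fin ltW.
Qed.

(** A bound on the logarithmic average over [S] of the norms on [Q] transfers to
    reducing operators, pointwise in [z]. Allowing [S'] to exceed [S] lets the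
    cubes [Q] and [S'] have different centres; S = S' is the other case of
    interest. *)
Lemma Ainf_quantity_transfer (p : Rn R n -> \bar R) W
    (A : cube R n -> 'M[R[i]]_m) : (0 < n)%N ->
  P0 p -> LH p -> matrix_weight W -> reducing_family p W A ->
  exists2 C : R, 0 < C & forall Q S S' (B : R),
    cube_set S `<=` cube_set S' ->
    (cube_edge S')%:num <= 3 * (cube_edge S)%:num ->
    0 < B -> (Ainf_quantity p W S Q <= B%:E)%E ->
    forall z : 'cV_m, cvnorm (A Q *m z) <= C * B * cvnorm (A S' *m z).
Proof.
move=> n0 [_ p0 pminus0] [r pE hr] [aeW lW] [c1 [c2 [c10 c20 redA]]].
subst p; pose p : Rn R n -> \bar R := EFin \o r.
have [pm pm0 rpm] : exists2 pm : R, 0 < pm & {ae leb, forall x, pm <= r x}.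
  have [pm pm0 pmp] : exists2 pm : R, 0 < pm & (pm%:E <= p_minus p)%E.
    rewrite /p; case: (p_minus _) pminus0 => [s| |] // s0; first by exists s.
    by exists 1 => //; rewrite leey.
  exists pm => //; move/ess_infP : pmp.
  by apply: filterS => x; rewrite lee_fin.
have r0 x : 0 < r x by have := p0 x; rewrite /= lte_fin.
have mr : measurable_fun [set: Rn R n] r by have [] := hr.
have [C C0 scale] := log_holder_indicator_scale n0 mr pm0 rpm hr.
pose K := (1 + C) `^ pm^-1.
have K0 : 0 < K by rewrite powR_gt0// addr_gt0.
have E0 : 0 < expR (2 * C + pm^-1) by exact: expR_gt0.
exists (c2 * expR (2 * C + pm^-1) * (2 * K / c1)).
  by rewrite !mulr_gt0// invr_gt0.
move=> Q S S' B sub SS' B0 QB z.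
have [->|z0] := eqVneq z 0; first by rewrite !mulmx0 !cvnorm0 mulr0.
have Apos (P : cube R n) : 0 < cvnorm (A P *m z).
  have [/positive_definite_unitmx uA _ _] := redA P.
  exact/cvnorm_gt0/unitmx_mulmx_neq0.
have [tau [g tg]] := scale S S' sub SS'.
have [tau0 _ _ _ [_ Itau]] := tg.
pose a := cvnorm (A S' *m z); pose b := cvnorm (A Q *m z).
pose h y := cvnorm (W y *m z).
pose N y := cube_norm p Q (fun x => opnorm (W x *m invmx (W y))).
(* The factor 2 makes the norm of h on S' strictly smaller than t, as a modular
   bound at t itself is read off from an infimum. *)
pose t := 2 * (K * tau * (a / c1)).
have a0 : 0 < a / c1 by rewrite divr_gt0//; exact: Apos.
have Kt0 : 0 < K * tau by rewrite mulr_gt0.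
have t0 : 0 < t by rewrite /t mulr_gt0// mulr_gt0.
have Lt : (Lpnorm p (fun x => h x * \1_(cube_set S') x)%R < t%:E)%E.
  apply: (@le_lt_trans _ _ (K * tau * (a / c1))%:E); last first.
    by rewrite lte_fin /t mulr_natl mulr2n ltrDl mulr_gt0.
  apply: Lpnorm_le_of_cube_norm => //.
    exact: Lpnorm_indicator_le.
  have [_ _ /(_ z)[lo _]] := redA S'.
  by rewrite mulrC EFinM lee_pdivlMl.
have aeN : {ae leb, forall y, cube_set S y ->
    0 < h y /\ ((b / c2)%:E <= N y * (h y)%:E)%E}.
  apply: filterS aeW => y [_ uW] _.
  have hy0 : 0 < h y by exact/cvnorm_gt0/unitmx_mulmx_neq0.
  split => //.
  have [_ _ /(_ z)[_ up]] := redA Q.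
  rewrite mulrC EFinM lee_pdivrMl//; apply: le_trans up _.
  rewrite lee_pmul2l// muleC; apply: cube_norm_le_scale => // x.
  rewrite ger0_norm ?cvnorm_ge0// mulrC.
  apply: (@le_trans _ _ (opnorm (W x *m invmx (W y)) * h y)).
    rewrite [W x *m z](_ : _ = W x *m invmx (W y) *m (W y *m z)).
      exact: cvnorm_mulmx_le.
    by rewrite mulmxA mulmxKV.
  by rewrite ler_wpM2r ?cvnorm_ge0// ler_norm.
have b0 : 0 < b / c2 by rewrite divr_gt0//; exact: Apos.
have := log_average_bound mr r0 pm0 rpm sub tg B0 b0 t0
  (measurable_cvnorm_mulmx z lW) Lt aeN QB.
rewrite ler_pdivrMr// => /le_trans; apply.
rewrite /t le_eqVlt; apply/orP; left; apply/eqP.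
by rewrite -/a; field; rewrite !gt_eqF.
Qed.

Lemma has_lower_dim_le (p : Rn R n -> \bar R) W (d d' : R) : d <= d' ->
  has_lower_dim p W d -> has_lower_dim p W d'.
Proof.
move=> dd' [C C0 H]; exists C => // lam Q lam1; apply: le_trans (H _ _ lam1) _.
by rewrite lee_fin ler_pM2l//; exact: ler_powR.
Qed.

Lemma has_upper_dim_le (p : Rn R n -> \bar R) W (d d' : R) : d <= d' ->
  has_upper_dim p W d -> has_upper_dim p W d'.
Proof.
move=> dd' [C C0 H]; exists C => // lam Q lam1; apply: le_trans (H _ _ lam1) _.
by rewrite lee_fin ler_pM2l//; exact: ler_powR.
Qed.

(** Dimensions are upward closed because the dilation factors are at least 1, so
    a number above their infimum lies above an actual dimension. *)
Lemma lower_interval_has_lower_dim (p : Rn R n -> \bar R) W (d : R) :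
  lower_interval p W d -> has_lower_dim p W d.
Proof.
rewrite /lower_interval; case: ifPn => [/asboolP[e -> he]|_] /= /andP[].
  by rewrite lee_fin => ed _; exact: has_lower_dim_le he.
move=> /ereal_inf_lt[_ [e /= [_ _ he] <-]]; rewrite lte_fin => /ltW ed _.
exact: has_lower_dim_le he.
Qed.

Lemma upper_interval_has_upper_dim (p : Rn R n -> \bar R) W (d : R) :
  upper_interval p W d -> has_upper_dim p W d.
Proof.
rewrite /upper_interval; case: ifPn => [/asboolP[e -> he]|_] /=.
  by rewrite lee_fin => ed; exact: has_upper_dim_le he.
move=> /ereal_inf_lt[_ [e /= [_ he] <-]]; rewrite lte_fin => /ltW ed.
exact: has_upper_dim_le he.
Qed.

End reducing_operators.

Lemma dilate_subset {R : realType} {n : nat} (Q S : cube R n) (lam mu : {posnum R}) :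
  lam%:num * (cube_edge Q)%:num
    + 2 * euclid_dist (cube_center Q) (cube_center S)
    < mu%:num * (cube_edge S)%:num ->
  cube_set (dilate lam Q) `<=` cube_set (dilate mu S).
Proof.
move=> H x /cube_set_le /= xQ; apply: cube_set_lt => i /=.
have := xQ i.
have := normB_le_euclid_dist (cube_center Q) (cube_center S) i.
have := ler_normD (tnth x i - tnth (cube_center Q) i)
  (tnth (cube_center Q) i - tnth (cube_center S) i).
rewrite addrA subrK.
move: H; lra.
Qed.

(** With L = max (a, b) + D, this is the product (L / a) ^ d1 (L / b) ^ d2 of the
    losses of the two dilations: one of max (a, b) / a and max (a, b) / b
    equals 1. *)
Lemma powR_dilation_factors {R : realType} (a b D d1 d2 : R) :
  0 < a -> 0 < b -> 0 <= D ->
  ((Num.max a b + D) / a) `^ d1 * ((Num.max a b + D) / b) `^ d2 <=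
  Num.max ((b / a) `^ d1) ((a / b) `^ d2)
    * (1 + D / Num.max a b) `^ (d1 + d2).
Proof.
move=> a0 b0 D0; set M := Num.max a b.
have M0 : 0 < M by rewrite lt_max a0.
have u0 : 0 < 1 + D / M by rewrite ltr_wpDr// divr_ge0// ltW.
have -> : M + D = M * (1 + D / M) by field; rewrite gt_eqF.
rewrite powRD; last by rewrite (gt_eqF u0) implybT.
have uge0 := ltW u0.
have Ma0 : 0 <= M / a by rewrite divr_ge0 ?(ltW M0) ?(ltW a0).
have Mb0 : 0 <= M / b by rewrite divr_ge0 ?(ltW M0) ?(ltW b0).
rewrite [M * _ / a]mulrAC [M * _ / b]mulrAC (powRM _ Ma0)// (powRM _ Mb0)//.
rewrite mulrACA ler_wpM2r ?mulr_ge0 ?powR_ge0// /M.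
have [ab|/ltW ba] := leP a b.
  by rewrite divff ?gt_eqF// powR1 mulr1 le_max lexx.
by rewrite divff ?gt_eqF// powR1 mul1r le_max lexx orbT.
Qed.

Theorem proposition3p27 (R : realType) (n m : nat) (hn : (0 < n)%N) (hm : (0 < m)%N)
  (p : Rn R n -> \bar R) (hp : P0 p) (hLH : LH p)
  (W : Rn R n -> 'M[R[i]]_m) (hW : Ainf p W)
  (d1 d2 : R) (hd1 : lower_interval p W d1) (hd2 : upper_interval p W d2)
  (A : cube R n -> 'M[R[i]]_m) (hA : reducing_family p W A) :
  exists2 C : R, 0 < C & forall Q S : cube R n,
    opnorm (A Q *m invmx (A S)) <=
      C * Num.max (((cube_edge S)%:num / (cube_edge Q)%:num) `^ d1)
                  (((cube_edge Q)%:num / (cube_edge S)%:num) `^ d2)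
        * (1 + euclid_dist (cube_center Q) (cube_center S)
                 / Num.max (cube_edge Q)%:num (cube_edge S)%:num) `^ (d1 + d2).
Proof.
have [C1 C10 low] := lower_interval_has_lower_dim hd1.
have [C2 C20 up] := upper_interval_has_upper_dim hd2.
have [C C0 transfer] := Ainf_quantity_transfer hn hp hLH hW.1 hA.
have d30 : 0 < 3 `^ d2 :> R by rewrite powR_gt0.
exists (C * C1 * (C * C2 * 3 `^ d2)) => [|Q S]; first by rewrite !mulr_gt0.
set a := (cube_edge Q)%:num; set b := (cube_edge S)%:num.
set D := euclid_dist _ _.
have a0 : 0 < a by rewrite /a.
have b0 : 0 < b by rewrite /b.
have D0 : 0 <= D by exact: sqrtr_ge0.
pose L := Num.max a b + D.
have aM : a <= Num.max a b by rewrite le_max lexx.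
have bM : b <= Num.max a b by rewrite le_max lexx orbT.
have lam0 : 0 < L / a by rewrite divr_gt0// /L; lra.
have mu0 : 0 < 3 * L / b by rewrite divr_gt0// /L; lra.
pose P := dilate (PosNum lam0) Q; pose P' := dilate (PosNum mu0) S.
have eP : (cube_edge P)%:num = L by rewrite /= -/a divfK ?gt_eqF.
have eP' : (cube_edge P')%:num = 3 * L by rewrite /= -/b divfK ?gt_eqF.
have PP' : cube_set P `<=` cube_set P'.
  apply: dilate_subset; rewrite -[X in X + _]/(cube_edge P)%:num.
  by rewrite -[X in _ < X]/(cube_edge P')%:num eP eP' -/D /L; lra.
have QP : (Ainf_quantity p W P Q <= (C1 * (L / a) `^ d1)%:E)%E.
  by apply: low => /=; rewrite ler_pdivlMr// mul1r /L; lra.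
have P'S : (Ainf_quantity p W S P' <= (C2 * (3 * L / b) `^ d2)%:E)%E.
  by apply: up => /=; rewrite ler_pdivlMr// mul1r /L; lra.
have uS : A S \in unitmx.
  by have [c1 [c2 [_ _ /(_ S)[/positive_definite_unitmx]]]] := hA.
apply: opnorm_le => v v1.
rewrite -mulmxA.
have B10 : 0 < C1 * (L / a) `^ d1 by rewrite mulr_gt0// powR_gt0.
have B20 : 0 < C2 * (3 * L / b) `^ d2 by rewrite mulr_gt0// powR_gt0.
have PP'3 : (cube_edge P')%:num <= 3 * (cube_edge P)%:num by rewrite eP eP'.
have S3 : (cube_edge S)%:num <= 3 * (cube_edge S)%:num.
  by rewrite -/b; lra.
apply: le_trans (transfer Q P P' _ PP' PP'3 B10 QP _) _.
have := transfer P' S S _ (@subset_refl _ _) S3 B20 P'S (invmx (A S) *m v).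
rewrite mulKVmx// => step2.
have {}step2 : cvnorm (A P' *m (invmx (A S) *m v)) <= C * (C2 * (3 * L / b) `^ d2).
  apply: le_trans step2 _; rewrite ler_piMr// ltW// mulr_gt0//.
apply: (@le_trans _ _ (C * (C1 * (L / a) `^ d1) * (C * (C2 * (3 * L / b) `^ d2)))).
  by rewrite ler_pM2l// mulr_gt0.
have -> : (3 * L / b) `^ d2 = 3 `^ d2 * (L / b) `^ d2.
  by rewrite -mulrA powRM// divr_ge0 ?(ltW b0)// /L; lra.
have := powR_dilation_factors d1 d2 a0 b0 D0.
rewrite -/L => H.
rewrite (_ : C * _ * _ = C * C1 * (C * C2 * 3 `^ d2) *
  ((L / a) `^ d1 * (L / b) `^ d2)); last by ring.
by rewrite -[leRHS]mulrA ler_pM2l// !mulr_gt0.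
Qed.
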